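(* Let $\alpha,\rho\in\mathbb{R}$, $\beta=0$, $p\in(2,6)$, $r\in(2,4)$, $\mu>0$, and assume that there exists a ground state at mass $\mu$ for the energy $E$, denoted by $U=(u,v)$. Then, up to multiplication by a constant phase, the following alternative holds. (i) If there is a ground state $\varphi_{\alpha,\mu}$ at mass $\mu$ for $E_\alpha(\cdot,\mathbb{R}^+)$ and $$E_\alpha(\varphi_{\alpha,\mu},\mathbb{R}^+)\leq E_\rho(v_{\rho,\mu},\mathbb{R}^2),$$ with $v_{\rho,\mu}$ a ground state at mass $\mu$ for $E_\rho(\cdot,\mathbb{R}^2)$, then $U=(\varphi_{\alpha,\mu},0)$ for some such ground state $\varphi_{\alpha,\mu}$ when the inequality is strict, while either $U=(\varphi_{\alpha,\mu},0)$ or $U=(0,v_{\rho,\mu})$ for some such ground states when equality holds. Moreover, the ground state energy is $\mathcal E(\mu)=E_\alpha(\varphi_{\alpha,\mu},\mathbb{R}^+)$. (ii) In all other cases, $U=(0,v_{\rho,\mu})$ for some ground state $v_{\rho,\mu}$ at mass $\mu$ for $E_\rho(\cdot,\mathbb{R}^2)$, and $\mathcal E(\mu)=E_\rho(v_{\rho,\mu},\mathbb{R}^2)$.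
   Context: All functions are complex-valued, $\mathbb{R}^+=(0,+\infty)$. $K_0$ is the Macdonald function (modified Bessel function of the second kind) of order $0$, with $K_0(\mathbf{x}):=K_0(|\mathbf{x}|)$ for $\mathbf{x}\in\mathbb{R}^2$, and $\gamma$ is the Euler–Mascheroni constant. Energy space on the plane: $\mathcal V=\{v=\phi+q\frac{K_0}{2\pi}:\phi\in H^1(\mathbb{R}^2),q\in\mathbb{C}\}$ ($\phi$ and $q$ are uniquely determined by $v$). Energy domain on the hybrid plane: $\mathcal D=\{U=(u,v):u\in H^1(\mathbb{R}^+),v\in\mathcal V\}$. For $U=(u,v)\in\mathcal D$, $E(U)=E_\alpha(u,\mathbb{R}^+)+E_\rho(v,\mathbb{R}^2)-\beta\,\mathrm{Re}(q\overline{u(0)})$, where $$E_\alpha(u,\mathbb{R}^+)=\tfrac12\|u'\|_{L^2(\mathbb{R}^+)}^2+\tfrac{\alpha}{2}|u(0)|^2-\tfrac1p\|u\|_{L^p(\mathbb{R}^+)}^p,$$ $$E_\rho(v,\mathbb{R}^2)=\tfrac12\|\phi\|_{H^1(\mathbb{R}^2)}^2-\tfrac12\|v\|_{L^2(\mathbb{R}^2)}^2+\Big(\rho+\tfrac{\gamma-\log2}{2\pi}\Big)\tfrac{|q|^2}{2}-\tfrac1r\|v\|_{L^r(\mathbb{R}^2)}^r,$$ with $\|\phi\|_{H^1}^2=\|\nabla\phi\|_{L^2}^2+\|\phi\|_{L^2}^2$. $\mathcal D_\mu=\{(u,v)\in\mathcal D:\|u\|_{L^2(\mathbb{R}^+)}^2+\|v\|_{L^2(\mathbb{R}^2)}^2=\mu\}$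 and $\mathcal E(\mu)=\inf_{\mathcal D_\mu}E$. A ground state at mass $\mu$ for $E$ is a $U\in\mathcal D_\mu$ with $E(U)=\mathcal E(\mu)>-\infty$. Likewise, a ground state at mass $\mu$ for $E_\alpha(\cdot,\mathbb{R}^+)$ (resp. $E_\rho(\cdot,\mathbb{R}^2)$) is a minimizer of it among $u\in H^1(\mathbb{R}^+)$ with $\|u\|_{L^2}^2=\mu$ (resp. among $v\in\mathcal V$ with $\|v\|_{L^2}^2=\mu$). It is known that a ground state for $E_\rho(\cdot,\mathbb{R}^2)$ exists for every $\mu>0$, $\rho\in\mathbb{R}$, $r\in(2,4)$. *)

(* Defs.v *)
From HB Require Import structures.
From mathcomp Require Import all_boot all_order all_algebra.
From mathcomp Require Import all_classical all_reals all_analysis.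
From mathcomp Require Import complex.
Set Implicit Arguments.
Unset Strict Implicit.
Unset Printing Implicit Defensive.
Import Order.TTheory GRing.Theory Num.Theory.
Import numFieldNormedType.Exports.
Import ComplexField.Normc.
Local Open Scope classical_set_scope.
Local Open Scope ring_scope.
Local Open Scope complex_scope.

Section SpecialFunctions.
Context {R : realType}.

Definition euler_gamma : R :=
  lim ((fun n : nat =>
    (\sum_(1 <= k < n.+1) k%:R^-1) - ln n%:R : R) @ \oo).

(* K_0(x) = \int_0^oo exp(- x cosh t) dt for x > 0.  At x = 0, where K_0 is
   infinite, this is a junk value, relevant only on a null set. *)
Definition macdonald0 (x : R) : R :=
  \int[lebesgue_measure]_(t in `[0, +oo[)
    expR (- (x * ((expR t + expR (- t)) / 2))).

(* The library norm on R * R is the sup norm, hence the explicit square root. *)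
Definition euclid (x : R * R) : R := Num.sqrt (x.1 ^+ 2 + x.2 ^+ 2).

End SpecialFunctions.

(* Real-valued test functions C_c^oo(D), for D an open set. *)
Section TestFunctions.
Context {R : realType} {V : normedModType R}.

(* C^n through iterated directional derivatives; on a finite-dimensional
   space this is the usual class C^n. *)
Fixpoint continuously_derivable (n : nat) (f : V -> R) : Prop :=
  continuous f /\
  match n with
  | 0 => True
  | n'.+1 => forall v : V,
      (forall x, derivable f x v) /\ continuously_derivable n' ('D_v f)
  end.

Definition test_function (D : set V) (f : V -> R) : Prop :=
  (forall n, continuously_derivable n f) /\
  exists K : set V, [/\ compact K, K `<=` D & forall x, ~ K x -> f x = 0].

End TestFunctions.

Section Spaces.
Context {R : realType}.

Definition half_line : {measure set (measurableTypeR R) -> \bar R} :=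
  mrestr (@lebesgue_measure R) (measurable_itv `]0, +oo[).

Definition plane : {measure set (measurableTypeR R * measurableTypeR R) -> \bar R} :=
  (@lebesgue_measure R \x @lebesgue_measure R)%E.

Definition normL d (T : measurableType d) (mu : {measure set T -> \bar R})
    (p : R) (f : T -> R[i]) : \bar R :=
  ('N[mu]_p%:E[EFin \o (fun x => normc (f x))])%E.

Definition square_integrable d (T : measurableType d)
    (mu : {measure set T -> \bar R}) (f : T -> R[i]) : Prop :=
  [/\ measurable_fun setT (fun x => complex.Re (f x)),
      measurable_fun setT (fun x => complex.Im (f x)) &
      (normL mu 2 f < +oo)%E].

Definition weak_derivative_half_line (f g : R -> R) : Prop :=
  forall psi : R -> R, test_function (`]0, +oo[ : set R) psi ->
    (\int[half_line]_x (f x * 'D_1 psi x))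
    = - (\int[half_line]_x (g x * psi x)).

Definition weak_derivative_plane (e : R * R) (f g : R * R -> R) : Prop :=
  forall psi : R * R -> R, test_function setT psi ->
    (\int[plane]_x (f x * 'D_e psi x)) = - (\int[plane]_x (g x * psi x)).

(* Complex-valued integrals are taken componentwise, so a property of a pair
   of complex functions such as being weak derivatives of each other is
   required of the real parts and of the imaginary parts. *)
Definition componentwise (T : Type) (P : (T -> R) -> (T -> R) -> Prop)
    (f g : T -> R[i]) : Prop :=
  P (fun x => complex.Re (f x)) (fun x => complex.Re (g x)) /\
  P (fun x => complex.Im (f x)) (fun x => complex.Im (g x)).

(* An element of H^1 is a representative of its a.e. class, stored with its
   weak derivatives, which it determines up to null sets. *)
Record H1_half_line := {
  h1_fun :> R -> R[i];
  h1_deriv : R -> R[i];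
  h1_fun_L2 : square_integrable half_line h1_fun;
  h1_deriv_L2 : square_integrable half_line h1_deriv;
  h1_derivP : componentwise weak_derivative_half_line h1_fun h1_deriv }.

Record H1_plane := {
  h2_fun :> R * R -> R[i];
  h2_dx : R * R -> R[i];
  h2_dy : R * R -> R[i];
  h2_fun_L2 : square_integrable plane h2_fun;
  h2_dx_L2 : square_integrable plane h2_dx;
  h2_dy_L2 : square_integrable plane h2_dy;
  h2_dxP : componentwise (weak_derivative_plane (1, 0)) h2_fun h2_dx;
  h2_dyP : componentwise (weak_derivative_plane (0, 1)) h2_fun h2_dy }.

(* u(0): the value at 0 of the representative of u continuous on [0, +oo[. *)
Definition trace0 (u : R -> R[i]) : R[i] :=
  xget 0 [set a | exists w : R -> R[i],
    [/\ {within `[0, +oo[, continuous (fun x => complex.Re (w x))},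
        {within `[0, +oo[, continuous (fun x => complex.Im (w x))},
        ae_eq half_line setT w u & w 0 = a]].

(* The energy space on the plane, parametrised by the pair (phi, q), which
   v = phi + q K_0 / (2 pi) determines uniquely. *)
Record energy_plane := { regular_part : H1_plane; charge_coeff : R[i] }.

Definition energy_plane_fun (v : energy_plane) (x : R * R) : R[i] :=
  regular_part v x + charge_coeff v * (macdonald0 (euclid x) / (2 * pi))%:C.

Definition hybrid := (H1_half_line * energy_plane)%type.

End Spaces.
Arguments H1_half_line : clear implicits.
Arguments H1_plane : clear implicits.
Arguments energy_plane : clear implicits.
Arguments hybrid : clear implicits.
Coercion energy_plane_fun : energy_plane >-> Funclass.

(* Energies take values in \bar R so that their definition does not rest on
   the finiteness of the L^p and L^r norms (Gagliardo-Nirenberg).  The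
   nonnegative terms are finite, so oo - oo cannot occur. *)
Section Energies.
Context {R : realType}.
Local Open Scope ereal_scope.

Definition half_line_energy (alpha p : R) (u : H1_half_line R) : \bar R :=
  (2^-1)%:E * normL half_line 2 (h1_deriv u) ^+ 2
  + (alpha / 2 * normc (trace0 u) ^+ 2)%:E
  - (p^-1)%:E * normL half_line p u `^ p.

Definition H1_plane_sqnorm (phi : H1_plane R) : \bar R :=
  (normL plane 2 (h2_dx phi) ^+ 2 + normL plane 2 (h2_dy phi) ^+ 2)
  + normL plane 2 phi ^+ 2.

Definition plane_energy (rho r : R) (v : energy_plane R) : \bar R :=
  (2^-1)%:E * H1_plane_sqnorm (regular_part v)
  - (2^-1)%:E * normL plane 2 v ^+ 2
  + ((rho + (euler_gamma - ln 2) / (2 * pi)) * (normc (charge_coeff v) ^+ 2 / 2))%:E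
  - (r^-1)%:E * normL plane r v `^ r.

Definition hybrid_energy (alpha beta rho p r : R) (U : hybrid R) : \bar R :=
  half_line_energy alpha p U.1 + plane_energy rho r U.2
  - (beta * complex.Re (charge_coeff U.2 * (trace0 U.1)^*))%:E.

Definition half_line_mass (u : H1_half_line R) : \bar R :=
  normL half_line 2 u ^+ 2.

Definition plane_mass (v : energy_plane R) : \bar R := normL plane 2 v ^+ 2.

Definition hybrid_mass (U : hybrid R) : \bar R :=
  half_line_mass U.1 + plane_mass U.2.

Definition energy_level (X : Type) (mass energy : X -> \bar R) (mu : R)
  : \bar R := ereal_inf [set energy x | x in [set x | mass x = mu%:E]].

Definition ground_state (X : Type) (mass energy : X -> \bar R) (mu : R)
    (x : X) : Prop :=
  [/\ mass x = mu%:E, energy x = energy_level mass energy mu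
    & -oo < energy_level mass energy mu].

Definition half_line_ground_state (alpha p mu : R) :=
  ground_state half_line_mass (half_line_energy alpha p) mu.

Definition plane_ground_state (rho r mu : R) :=
  ground_state plane_mass (plane_energy rho r) mu.

Definition hybrid_ground_state (alpha beta rho p r mu : R) :=
  ground_state hybrid_mass (hybrid_energy alpha beta rho p r) mu.

Definition hybrid_level (alpha beta rho p r mu : R) : \bar R :=
  energy_level hybrid_mass (hybrid_energy alpha beta rho p r) mu.

(* c U = (f, g), as a.e. classes. *)
Definition multiple_is (c : R[i]) (U : hybrid R) (f : R -> R[i])
    (g : R * R -> R[i]) : Prop :=
  ae_eq half_line setT (fun x => c * U.1 x)%R f /\
  ae_eq plane setT (fun x => c * U.2 x)%R g.

End Energies.

(* Main.v *)
(* With beta = 0 the energy splits, and each part of a ground state (u, v) can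
   be rescaled separately: E(c u, d v) = c^2 A - c^p B + d^2 C - d^r D.  If both
   masses m1, m2 were positive, moving the whole mass mu to u (c^2 = mu / m1,
   d = 0) or to v (c = 0, d^2 = mu / m2) would multiply A - B, resp. C - D, by
   mu / m1, resp. mu / m2, with a further strict gain since p, r > 2; weighting
   the two minimality inequalities by m1 / mu and m2 / mu and adding them gives
   E(U) < E(U).  So one part has mass zero.  It can be rescaled without changing
   the mass, hence its energy vanishes, and the other part is a ground state for
   its own energy.  No regularity theory enters: the L^p and L^r norms of U are
   finite because the level is not -oo, and a nontrivial pair (phi, q)
   representing v = 0 is harmless, since the rescaling argument gives it zero
   energy. *)
Require Import Defs.
From mathcomp Require Import all_boot all_order all_algebra.
From mathcomp Require Import all_classical all_reals all_analysis.
From mathcomp Require Import measurable_realfun complex.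
From mathcomp Require Import ring lra.
Import Order.TTheory GRing.Theory Num.Theory.
Import numFieldNormedType.Exports.
Import ComplexField.Normc.
Local Open Scope ring_scope.
Set Implicit Arguments.
Unset Strict Implicit.
Unset Printing Implicit Defensive.

(** * Homogeneity of integrals and norms under nonnegative factors *)

Section IntegralScaling.
Local Open Scope ereal_scope.
Import HBNNSimple.
Context d (T : measurableType d) (R : realType).
Context (mu : {measure set T -> \bar R}).

(* The lemmas ge0_integralZl and integralZl of the library ask for
   measurability or integrability, which for a nonnegative factor the
   definition by suprema of simple functions makes superfluous. *)
Lemma le_integralZl_any (c : R) (f : T -> \bar R) :
  (0 < c)%R -> (forall x, 0 <= f x) ->
  c%:E * (\int[mu]_x f x) <= \int[mu]_x (c%:E * f x).
Proof.
move=> c0 f0.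
rewrite [in X in X <= _]ge0_integralTE// ge0_integralTE; last first.
  by move=> x; rewrite mule_ge0// lee_fin ltW.
(* Dividing by [c] leaves a bound for each simple [h] below [f]; then [c h] is a simple function
   below [c f]. *)
rewrite muleC -lee_pdivlMr//; apply: ge_ereal_sup => _ [h hf <-].
rewrite lee_pdivlMr// muleC -sintegralrM.
apply: ereal_sup_ubound; exists (scale_nnsfun h (ltW c0)) => //= x.
by rewrite EFinM lee_pmul2l.
Qed.

Lemma ge0_integralZl_any (c : R) (f : T -> \bar R) :
  (0 <= c)%R -> (forall x, 0 <= f x) ->
  \int[mu]_x (c%:E * f x) = c%:E * (\int[mu]_x f x).
Proof.
rewrite le_eqVlt => /predU1P[<- f0|c0 f0].
  by rewrite mul0e; apply: integral0_eq => x _; rewrite mul0e.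
apply/eqP; rewrite eq_le le_integralZl_any// andbT.
(* The reverse inequality is the one already proved, for [c^-1] and [c f]. *)
have ci0 : (0 < c^-1)%R by rewrite invr_gt0.
have cf0 x : 0 <= c%:E * f x by rewrite mule_ge0// lee_fin ltW.
rewrite muleC -lee_pdivrMr// muleC (le_trans (le_integralZl_any ci0 cf0))//.
rewrite le_eqVlt; apply/orP; left; apply/eqP; apply: eq_integral => x _.
by rewrite muleA -EFinM mulVf ?gt_eqF// mul1e.
Qed.

Lemma integralZl_any (c : R) (f : T -> \bar R) : (0 <= c)%R ->
  \int[mu]_x (c%:E * f x) = c%:E * (\int[mu]_x f x).
Proof.
move=> c0; rewrite integralE [in RHS]integralE.
rewrite (ge0_funeposM f c0) (ge0_funenegM f c0) !ge0_integralZl_any//.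
have : 0 <= \int[mu]_x f^\+ x by exact: integral_ge0.
have : 0 <= \int[mu]_x f^\- x by exact: integral_ge0.
move: c0; rewrite le_eqVlt => /predU1P[<- _ _|c0].
  by rewrite !mul0e sube0.
(* Multiplication by [c > 0] preserves every infinite value, including the conventional value of
   [oo - oo]. *)
case: (\int[mu]_x f^\- x) => [b| |]// b0;
  case: (\int[mu]_x f^\+ x) => [a| |]// a0;
  rewrite ?gt0_mulye ?gt0_muley ?gt0_muleNy ?lte_fin//=.
by rewrite -EFinM -!EFinD -EFinM mulrBr.
Qed.

Lemma Rintegral_Zl_any (c : R) (f : T -> R) : (0 <= c)%R ->
  (\int[mu]_x (c * f x) = c * \int[mu]_x f x)%R.
Proof.
move=> c0; rewrite /Rintegral.
under eq_integral do rewrite EFinM.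
rewrite integralZl_any//.
(* [fine] sends both infinities to 0, so both sides are 0 when the integral of [f] is infinite. *)
case: (integral _ _ _) => [a//| |] /=; rewrite mulr0;
  move: c0; rewrite le_eqVlt => /predU1P[<-|c0]; rewrite ?mul0e//.
  by rewrite gt0_muley ?lte_fin.
by rewrite gt0_muleNy ?lte_fin.
Qed.

Lemma normc_real (c : R) (z : R[i]) : (0 <= c)%R ->
  normc (c%:C%C * z)%R = (c * normc z)%R.
Proof. by move=> c0; rewrite normcM /= expr0n/= addr0 sqrtr_sqr ger0_norm. Qed.

Lemma normL_ge0 (q : R) (f : T -> R[i]) : 0 <= normL mu q f.
Proof. exact: Lnorm_ge0. Qed.

Lemma normL_scale (q c : R) (f : T -> R[i]) : (0 < q)%R -> (0 <= c)%R ->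
  normL mu q (fun x => c%:C%C * f x)%R = c%:E * normL mu q f.
Proof.
move=> q0 c0; rewrite /normL unlock /=.
have -> : (fun x => `|(normc (c%:C%C * f x)%R)%:E| `^ q) =
    (fun x => (c `^ q)%:E * (`|(normc (f x))%:E| `^ q)).
  apply/funext => x; rewrite normc_real// -poweR_EFin -poweRM ?lee_fin//.
  by rewrite EFinM abseM (gee0_abs (_ : 0 <= c%:E)) ?lee_fin.
rewrite ge0_integralZl_any ?powR_ge0//; last by move=> x; rewrite poweR_ge0.
rewrite poweRM ?lee_fin ?powR_ge0//; last first.
  by apply: integral_ge0 => x _; rewrite poweR_ge0.
by rewrite poweR_EFin -powRrM mulfV ?gt_eqF// powRr1.
Qed.

Lemma square_integrable_scale (c : R) (f : T -> R[i]) : (0 <= c)%R ->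
  square_integrable mu f -> square_integrable mu (fun x => c%:C%C * f x)%R.
Proof.
move=> c0 [mr mi fin]; split.
- rewrite (_ : (fun _ => _) = fun x => (c * complex.Re (f x))%R).
    exact: measurable_funM.
  by apply/funext => x; case: (f x) => a b /=; rewrite mul0r subr0.
- rewrite (_ : (fun _ => _) = fun x => (c * complex.Im (f x))%R).
    exact: measurable_funM.
  by apply/funext => x; case: (f x) => a b /=; rewrite mul0r addr0.
- by rewrite normL_scale// lte_mul_pinfty.
Qed.

End IntegralScaling.

(** * Uniqueness and homogeneity of the trace at 0 *)

Section Trace.
Context (R : realType).
Local Open Scope classical_set_scope.

(** A nonzero [g 0] would keep [g] nonzero on some []0, e[], which has positive measure [e]. *)
Lemma within_continuous_ae0 (g : R -> R) :
  {within `[0, +oo[, continuous g} ->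
  ae_eq half_line setT g (cst 0) -> g 0 = 0.
Proof.
move=> /subspace_continuousP /(_ 0) gc [N [mN N0 sub]].
apply: contrapT => /eqP g0.
have {}gc : g x @[x --> within `[0, +oo[ (nbhs (0 : R))] --> g 0.
  by apply: gc => /=; rewrite in_itv /= lexx.
have [e /= e0 he] : nbhs (0 : R) [set x | `[0, +oo[ x -> g x != 0].
  apply: (gc [set y | y != 0]).
  by apply: open_nbhs_nbhs; split => //; exact: open_neq.
have eN : `]0, e[ `<=` N.
  move=> x /=; rewrite in_itv/= => /andP[x0 xe].
  apply: sub => /= /(_ I) gx0.
  have : g x != 0.
    by apply: he => /=; rewrite ?in_itv/= ?ltW// sub0r normrN gtr0_norm.
  by rewrite gx0 eqxx.
have : (half_line (`]0%R, e[%classic : set R) <= half_line N)%E.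
  by apply: le_measure => //; rewrite inE.
rewrite N0 /half_line/= /mrestr setIidl; last first.
  by move=> x /=; rewrite !in_itv/= => /andP[->].
by rewrite lebesgue_measure_itv/= lte_fin e0 sube0 lee_fin leNgt e0.
Qed.

(** The condition from which [trace0] chooses by [xget]; naming it separates the existence of a
    continuous representative from the chosen value. *)
Definition is_trace0 (u : R -> R[i]) (a : R[i]) : Prop :=
  exists w : R -> R[i],
    [/\ {within `[0, +oo[, continuous (fun x => complex.Re (w x))},
        {within `[0, +oo[, continuous (fun x => complex.Im (w x))},
        ae_eq half_line setT w u & w 0 = a].

Lemma is_trace0_unique (u : R -> R[i]) (a b : R[i]) :
  is_trace0 u a -> is_trace0 u b -> a = b.
Proof.
move=> [w [wr wi wu <-]] [z [zr zi zu <-]].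
have wz : ae_eq half_line setT w z by apply: ae_eq_trans wu (ae_eq_sym zu).
have rE : complex.Re (w 0) = complex.Re (z 0).
  apply/eqP; rewrite -subr_eq0; apply/eqP.
  apply: (within_continuous_ae0 (within_continuousB wr zr)).
  by apply: filterS wz => x /[apply] wzx; rewrite /= !fctE wzx subrr.
have iE : complex.Im (w 0) = complex.Im (z 0).
  apply/eqP; rewrite -subr_eq0; apply/eqP.
  apply: (within_continuous_ae0 (within_continuousB wi zi)).
  by apply: filterS wz => x /[apply] wzx; rewrite /= !fctE wzx subrr.
by rewrite [w 0]complexE [z 0]complexE rE iE.
Qed.

Lemma trace0_eq (u : R -> R[i]) (a : R[i]) : is_trace0 u a -> trace0 u = a.
Proof.
by move=> ua; apply: xget_unique => // b ub; exact: is_trace0_unique ub ua.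
Qed.

Lemma is_trace0_scale (c : R) (u : R -> R[i]) (a : R[i]) :
  is_trace0 u a -> is_trace0 (fun x => c%:C%C * u x) (c%:C%C * a).
Proof.
move=> [w [wr wi wu <-]]; exists (fun x => c%:C%C * w x); split => //.
- rewrite (_ : (fun _ => _) = fun x => c * complex.Re (w x)).
    by move=> x; apply: cvgMr; exact: wr.
  by apply/funext => x; case: (w x) => ? ? /=; rewrite mul0r subr0.
- rewrite (_ : (fun _ => _) = fun x => c * complex.Im (w x)).
    by move=> x; apply: cvgMr; exact: wi.
  by apply/funext => x; case: (w x) => ? ? /=; rewrite mul0r addr0.
- by apply: filterS wu => x /[apply] ->.
Qed.

(** For nonzero [c], scaling back by [c^-1] shows that [u] and [c u] have continuous representatives
    together; when neither has one, both traces are the default value 0. *)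
Lemma trace0_scale (c : R) (u : R -> R[i]) :
  trace0 (fun x => c%:C%C * u x) = c%:C%C * trace0 u.
Proof.
have [->|c0] := eqVneq c 0.
  rewrite mul0r; apply: trace0_eq; exists (cst 0); split => //.
  - by apply: continuous_subspaceT => x; exact: cvg_cst.
  - by apply: continuous_subspaceT => x; exact: cvg_cst.
  - by apply: nearW => x _; rewrite mul0r.
have [[a ua]|nu] := pselect (exists a, is_trace0 u a).
  by rewrite (trace0_eq ua); apply/trace0_eq/is_trace0_scale.
rewrite /trace0 !xgetPN ?mulr0//.
- by move=> a ua; apply: nu; exists a.
- move=> a /(is_trace0_scale c^-1) ua; apply: nu; exists ((c^-1)%:C%C * a).
  congr (is_trace0 _ _) : ua; apply/funext => x.
  by rewrite mulrA -rmorphM mulVf// mul1r.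
Qed.

End Trace.

(** * Measurability of the moduli, and vanishing norms *)

Section Measurability.
Context (R : realType).

(** Tonelli: the integrand is nonnegative and jointly measurable. The indicator in [h] turns the
    integral over [[0, +oo[] into one over the whole line. *)
Lemma measurable_macdonald0 :
  measurable_fun [set: measurableTypeR R] (@macdonald0 R).
Proof.
apply: measurableT_comp => //.
pose h (z : measurableTypeR R * measurableTypeR R) : R :=
  expR (- (z.1 * ((expR z.2 + expR (- z.2)) / 2))) * \1_(`[0, +oo[%classic) z.2.
have m2 : measurable_fun setT
    (fun z : measurableTypeR R * measurableTypeR R => z.2 : R).
  exact: measurable_snd.
have m1 : measurable_fun setT
    (fun z : measurableTypeR R * measurableTypeR R => z.1 : R).
  exact: measurable_fst.
have mh : measurable_fun setT h.
  apply: measurable_funM; last first.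
    by apply: (measurableT_comp _ m2); exact: measurable_indic.
  apply: (measurableT_comp (@measurable_expR R)).
  apply: measurable_funN; apply: measurable_funM => //.
  apply: measurable_funM => //; apply: measurable_funD.
    exact: (measurableT_comp (@measurable_expR R) m2).
  exact: (measurableT_comp (@measurable_expR R) (measurable_funN m2)).
have h0 z : (0 <= (h z)%:E)%E by rewrite lee_fin mulr_ge0 ?expR_ge0.
have mhE : measurable_fun setT (EFin \o h) by apply/measurable_EFinP.
have := measurable_fun_fubini_tonelli_F (m2 := @lebesgue_measure R) _ mhE h0.
congr measurable_fun; apply/funext => x; rewrite /fubini_F /=.
rewrite [RHS]integral_mkcond; apply: eq_integral => t _.
rewrite patchE /h /= indicE; case: ifP => _ /=; first by rewrite mulr1.
by rewrite mulr0.
Qed.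

Lemma measurable_euclid :
  measurable_fun [set: measurableTypeR R * measurableTypeR R] (@euclid R).
Proof.
apply: (measurableT_comp (f := @Num.sqrt R)).
  by apply: continuous_measurable_fun; exact: sqrt_continuous.
by apply: measurable_funD; apply: measurable_funX.
Qed.

Lemma measurable_normc d (T : measurableType d) (f : T -> R[i]) :
  measurable_fun setT (fun x => complex.Re (f x)) ->
  measurable_fun setT (fun x => complex.Im (f x)) ->
  measurable_fun setT (fun x => normc (f x)).
Proof.
move=> mr mi.
rewrite (_ : (fun _ => _) =
    Num.sqrt \o (fun x => complex.Re (f x) ^+ 2 + complex.Im (f x) ^+ 2)).
  apply: measurableT_comp.
    by apply: continuous_measurable_fun; exact: sqrt_continuous.
  by apply: measurable_funD; apply: measurable_funX.
by apply/funext => x /=; case: (f x) => a b; rewrite /normc /=.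
Qed.

Lemma measurable_normc_half_line (u : H1_half_line R) :
  measurable_fun [set: measurableTypeR R] (fun x => normc (u x)).
Proof. by have [] := h1_fun_L2 u; move=> *; exact: measurable_normc. Qed.

Lemma measurable_normc_plane (v : energy_plane R) :
  measurable_fun [set: measurableTypeR R * measurableTypeR R]
    (fun x => normc (v x)).
Proof.
have [mr mi _] := h2_fun_L2 (regular_part v).
have mK : measurable_fun [set: measurableTypeR R * measurableTypeR R]
    (fun x => macdonald0 (euclid x) / (2 * pi) : R).
  apply: measurable_funM => //.
  exact: (measurableT_comp measurable_macdonald0 measurable_euclid).
apply: measurable_normc.
- rewrite (_ : (fun _ => _) = fun x => complex.Re (regular_part v x)
      + complex.Re (charge_coeff v) * (macdonald0 (euclid x) / (2 * pi))).
    by apply: measurable_funD => //; exact: measurable_funM.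
  apply/funext => x; rewrite /energy_plane_fun.
  case: (regular_part v x) (charge_coeff v) => [a b] [e f] /=.
  by rewrite mulr0 subr0.
- rewrite (_ : (fun _ => _) = fun x => complex.Im (regular_part v x)
      + complex.Im (charge_coeff v) * (macdonald0 (euclid x) / (2 * pi))).
    by apply: measurable_funD => //; exact: measurable_funM.
  apply/funext => x; rewrite /energy_plane_fun.
  case: (regular_part v x) (charge_coeff v) => [a b] [e f] /=.
  by rewrite mulr0 add0r.
Qed.

Lemma normL_eq0 d (T : measurableType d) (mu : {measure set T -> \bar R})
    (q : R) (f : T -> R[i]) :
  0 < q -> measurable_fun setT (fun x => normc (f x)) ->
  normL mu q f = 0%E -> ae_eq mu setT f (fun=> 0).
Proof.
move=> q0 mf /Lnorm_eq0_eq0 -/(_ _ _)/wrap[||h].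
- exact/measurable_EFinP.
- by rewrite lte_fin.
- by apply: filterS h => x /[apply] -[] /eq0_normc.
Qed.

(** Combined with [normL_eq0], it carries the vanishing of a norm from one exponent to another. *)
Lemma ae0_normL d (T : measurableType d) (mu : {measure set T -> \bar R})
    (q : R) (f : T -> R[i]) :
  0 < q -> measurable_fun setT (fun x => normc (f x)) ->
  ae_eq mu setT f (fun=> 0) -> normL mu q f = 0%E.
Proof.
move=> q0 mf f0; rewrite /normL unlock /=.
rewrite (ae_eq_integral (cst 0%E)) //.
- by rewrite integral0 poweR0r// invr_neq0// gt_eqF.
- apply/measurable_EFinP; apply: (measurableT_comp (measurable_powR q)).
  exact: measurableT_comp.
- by apply: filterS f0 => x /[apply] ->; rewrite normc0 /= normr0 powR0 ?gt_eqF.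
Qed.

End Measurability.

(** * Dilations of the function spaces, and their effect on masses *)

Section ScaledElements.
Context (R : realType) (c : R) (c0 : 0 <= c).

Lemma componentwise_scale (T : Type) (P : (T -> R) -> (T -> R) -> Prop) :
  (forall f g, P f g -> P (fun x => c * f x) (fun x => c * g x)) ->
  forall f g : T -> R[i], componentwise P f g ->
  componentwise P (fun x => c%:C%C * f x) (fun x => c%:C%C * g x).
Proof.
move=> PZ f g [/PZ Pr /PZ Pi].
have rE (h : T -> R[i]) : (fun x => complex.Re (c%:C%C * h x)) =
    (fun x => c * complex.Re (h x)).
  by apply/funext => x; case: (h x) => a b /=; rewrite mul0r subr0.
have iE (h : T -> R[i]) : (fun x => complex.Im (c%:C%C * h x)) =
    (fun x => c * complex.Im (h x)).
  by apply/funext => x; case: (h x) => a b /=; rewrite mul0r addr0.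
by split; rewrite ?rE ?iE.
Qed.

(** [Rintegral_Zl_any] takes [c] out of both integrals, whether they are finite or not. *)
Lemma weak_derivative_half_line_scale (f g : R -> R) :
  weak_derivative_half_line f g ->
  weak_derivative_half_line (fun x => c * f x) (fun x => c * g x).
Proof.
move=> fg psi /fg fgpsi.
under eq_Rintegral do rewrite -mulrA.
rewrite Rintegral_Zl_any// fgpsi mulrN -Rintegral_Zl_any//.
by congr (- _); apply: eq_Rintegral => x _; rewrite mulrA.
Qed.

Lemma weak_derivative_plane_scale (e : R * R) (f g : R * R -> R) :
  weak_derivative_plane e f g ->
  weak_derivative_plane e (fun x => c * f x) (fun x => c * g x).
Proof.
move=> fg psi /fg fgpsi.
under eq_Rintegral do rewrite -mulrA.
rewrite Rintegral_Zl_any// fgpsi mulrN -Rintegral_Zl_any//.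
by congr (- _); apply: eq_Rintegral => x _; rewrite mulrA.
Qed.

Definition scale_half_line (u : H1_half_line R) : H1_half_line R :=
  Build_H1_half_line
    (square_integrable_scale c0 (h1_fun_L2 u))
    (square_integrable_scale c0 (h1_deriv_L2 u))
    (componentwise_scale weak_derivative_half_line_scale (h1_derivP u)).

Definition scale_H1_plane (phi : H1_plane R) : H1_plane R :=
  Build_H1_plane
    (square_integrable_scale c0 (h2_fun_L2 phi))
    (square_integrable_scale c0 (h2_dx_L2 phi))
    (square_integrable_scale c0 (h2_dy_L2 phi))
    (componentwise_scale (@weak_derivative_plane_scale (1, 0)) (h2_dxP phi))
    (componentwise_scale (@weak_derivative_plane_scale (0, 1)) (h2_dyP phi)).

Definition scale_plane (v : energy_plane R) : energy_plane R :=
  Build_energy_plane (scale_H1_plane (regular_part v))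
    (c%:C%C * charge_coeff v).

Lemma scale_planeE (v : energy_plane R) :
  (scale_plane v : R * R -> R[i]) = (fun x => c%:C%C * v x).
Proof.
by apply/funext => x; rewrite /energy_plane_fun [RHS]mulrDr [in RHS]mulrA.
Qed.

Local Open Scope ereal_scope.

Lemma normL2_scale d (T : measurableType d) (mu : {measure set T -> \bar R})
    (f : T -> R[i]) :
  normL mu 2 (fun x => c%:C%C * f x)%R ^+ 2 = (c ^+ 2)%:E * normL mu 2 f ^+ 2.
Proof. by rewrite normL_scale// EFin_expe !expe2 muleACA. Qed.

Lemma normL_powR_scale d (T : measurableType d)
    (mu : {measure set T -> \bar R}) (q : R) (f : T -> R[i]) : (0 < q)%R ->
  normL mu q (fun x => c%:C%C * f x)%R `^ q = (c `^ q)%:E * normL mu q f `^ q.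
Proof.
by move=> q0; rewrite normL_scale// poweRM ?lee_fin ?normL_ge0// poweR_EFin.
Qed.

Lemma half_line_mass_scale (u : H1_half_line R) :
  half_line_mass (scale_half_line u) = (c ^+ 2)%:E * half_line_mass u.
Proof. exact: normL2_scale. Qed.

Lemma plane_mass_scale (v : energy_plane R) :
  plane_mass (scale_plane v) = (c ^+ 2)%:E * plane_mass v.
Proof. by rewrite /plane_mass scale_planeE normL2_scale. Qed.

Lemma H1_plane_sqnorm_scale (phi : H1_plane R) :
  H1_plane_sqnorm (scale_H1_plane phi) = (c ^+ 2)%:E * H1_plane_sqnorm phi.
Proof.
rewrite /H1_plane_sqnorm.
have nL2 (f : R * R -> R[i]) :
  normL plane 2 (fun x => c%:C%C * f x)%R ^+ 2 =
    (c ^+ 2)%:E * normL plane 2 f ^+ 2.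
  exact: normL2_scale.
rewrite !ge0_muleDr ?adde_ge0 ?expe_ge0 ?normL_ge0//.
by congr (_ + _ + _); exact: nL2.
Qed.

End ScaledElements.

(** * Splitting of the energies into a real quadratic part and a power term *)

Section RealEnergies.
Context (R : realType).

(** The part of the energy that is homogeneous of degree 2; [fine] loses nothing, by
    [h1_deriv_L2]. *)
Definition half_line_quadratic (alpha : R) (u : H1_half_line R) : R :=
  fine (normL half_line 2 (h1_deriv u)) ^+ 2 / 2
  + alpha / 2 * normc (trace0 u) ^+ 2.

(** The analogue on the plane; [fine] is faithful on the mass only when the latter is finite, hence
    the premise of [plane_energyE]. *)
Definition plane_quadratic (rho : R) (v : energy_plane R) : R :=
  fine (H1_plane_sqnorm (regular_part v)) / 2 - fine (plane_mass v) / 2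
  + (rho + (euler_gamma - ln 2) / (2 * pi)) * (normc (charge_coeff v) ^+ 2 / 2).

Local Open Scope ereal_scope.

Lemma half_line_energyE (alpha p : R) (u : H1_half_line R) :
  half_line_energy alpha p u = (half_line_quadratic alpha u)%:E
    - (p^-1)%:E * normL half_line p u `^ p.
Proof.
have [_ _ finu] := h1_deriv_L2 u.
have : normL half_line 2 (h1_deriv u) \is a fin_num.
  by rewrite ge0_fin_numE ?normL_ge0.
rewrite /half_line_energy /half_line_quadratic.
case: (normL half_line 2 (h1_deriv u)) => // a _.
by rewrite -EFin_expe -EFinM -EFinD mulrC.
Qed.

Lemma H1_plane_sqnorm_fin (phi : H1_plane R) :
  H1_plane_sqnorm phi \is a fin_num.
Proof.
have fin (f : R * R -> R[i]) : square_integrable plane f ->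
    normL plane 2 f \is a fin_num.
  by move=> [_ _ finf]; rewrite ge0_fin_numE ?normL_ge0.
rewrite /H1_plane_sqnorm !fin_numD !fin_numX ?fin//.
- exact: h2_fun_L2.
- exact: h2_dy_L2.
- exact: h2_dx_L2.
Qed.

Lemma plane_energyE (rho r : R) (v : energy_plane R) :
  plane_mass v \is a fin_num ->
  plane_energy rho r v = (plane_quadratic rho v)%:E
    - (r^-1)%:E * normL plane r v `^ r.
Proof.
rewrite /plane_energy /plane_quadratic /plane_mass.
case: (normL plane 2 v ^+ 2) => // m _.
case: (H1_plane_sqnorm _) (H1_plane_sqnorm_fin (regular_part v)) => // h _ /=.
by rewrite -!EFinM -EFinB -EFinD (mulrC h) (mulrC m).
Qed.

Context (c : R) (c0 : (0 <= c)%R).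

(** The quadratic part has degree 2 and the power term degree [p]. At [c = 0] the energy is 0, so
    dilation by 0 provides the zero element. *)
Lemma half_line_energy_scale (alpha p B : R) (u : H1_half_line R) :
  (0 < p)%R -> normL half_line p u `^ p = B%:E ->
  half_line_energy alpha p (scale_half_line c0 u) =
    (c ^+ 2 * half_line_quadratic alpha u - c `^ p * (B / p))%:E.
Proof.
move=> p0 BE; rewrite half_line_energyE EFinB; congr (_ - _); last first.
  rewrite [X in _ * X](_ : _ = (c `^ p)%:E * normL half_line p u `^ p).
    by rewrite BE -!EFinM mulrCA [(p^-1 * B)%R]mulrC.
  exact: normL_powR_scale.
congr (_%:E); rewrite /half_line_quadratic.
rewrite [normL _ _ _](_ : _ = c%:E * normL half_line 2 (h1_deriv u)).
  rewrite [trace0 _](_ : _ = (c%:C%C * trace0 u)%R); last exact: trace0_scale.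
  have [_ _ finu] := h1_deriv_L2 u.
  rewrite normc_real// fineM ?ge0_fin_numE ?normL_ge0 ?ltry//=; ring.
exact: normL_scale.
Qed.

Lemma plane_energy_scale (rho r D : R) (v : energy_plane R) :
  (0 < r)%R -> plane_mass v \is a fin_num -> normL plane r v `^ r = D%:E ->
  plane_energy rho r (scale_plane c0 v) =
    (c ^+ 2 * plane_quadratic rho v - c `^ r * (D / r))%:E.
Proof.
move=> r0 mfin DE; rewrite plane_energyE; last first.
  by rewrite plane_mass_scale fin_numM.
rewrite EFinB; congr (_ - _); last first.
  rewrite scale_planeE normL_powR_scale// DE -!EFinM.
  by rewrite mulrCA [(r^-1 * D)%R]mulrC.
congr (_%:E); rewrite /plane_quadratic plane_mass_scale.
rewrite [regular_part _]/(scale_H1_plane c0 (regular_part v)).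
rewrite [charge_coeff _]/(c%:C%C * charge_coeff v)%R.
rewrite H1_plane_sqnorm_scale normc_real//.
rewrite (fineM _ (H1_plane_sqnorm_fin _))// (fineM _ mfin)//=; ring.
Qed.

End RealEnergies.

(** * Comparison of a hybrid ground state with its rescalings *)

Section Alternative.
Context (R : realType) (alpha rho p r mu : R).
Context (hp : 2 < p < 6) (hr : 2 < r < 4) (hmu : 0 < mu).
Context (U : hybrid R) (hU : hybrid_ground_state alpha 0 rho p r mu U).

Let p0 : 0 < p. Proof. by move: hp => /andP[/(lt_trans _)->]. Qed.
Let r0 : 0 < r. Proof. by move: hr => /andP[/(lt_trans _)->]. Qed.

(** [B] and [D] include the factors [1/p] and [1/r], so that [A - B] and [C - D] are the energies of
    the two parts. [masses_fin] and [energies_fin] show that [fine] is harmless here. *)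
Local Notation m1 := (fine (half_line_mass U.1)).
Local Notation m2 := (fine (plane_mass U.2)).
Local Notation B := (fine (normL half_line p U.1 `^ p)%E / p).
Local Notation D := (fine (normL plane r U.2 `^ r)%E / r).
Local Notation A := (half_line_quadratic alpha U.1).
Local Notation C := (plane_quadratic rho U.2).
Local Notation L := (hybrid_level alpha 0 rho p r mu).

(** Nonnegative masses with finite sum [mu] are both finite. *)
Let masses_fin : [/\ half_line_mass U.1 = m1%:E, plane_mass U.2 = m2%:E,
  0 <= m1, 0 <= m2 & m1 + m2 = mu].
Proof.
have [mU _ _] := hU; move: mU; rewrite /hybrid_mass.
have : (0 <= half_line_mass U.1)%E by rewrite expe_ge0 ?normL_ge0.
have : (0 <= plane_mass U.2)%E by rewrite expe_ge0 ?normL_ge0.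
case: (half_line_mass U.1) => [a| |]//; case: (plane_mass U.2) => [b| |]//=.
by rewrite !lee_fin -EFinD => b0 a0 [->].
Qed.

Lemma hybrid_energy0 (W : hybrid R) : hybrid_energy alpha 0 rho p r W =
  (half_line_energy alpha p W.1 + plane_energy rho r W.2)%E.
Proof. by rewrite /hybrid_energy mul0r sube0. Qed.

Lemma hybrid_level_le (W : hybrid R) : hybrid_mass W = mu%:E ->
  (L <= half_line_energy alpha p W.1 + plane_energy rho r W.2)%E.
Proof.
by move=> mW; apply: ereal_inf_lbound; exists W => //; exact: hybrid_energy0.
Qed.

(** An infinite power term would make the energy of [U] equal to [-oo], against the lower bound on
    the level. *)
Let energies_fin : [/\ (normL half_line p U.1 `^ p = (p * B)%:E)%E,
  (normL plane r U.2 `^ r = (r * D)%:E)%E, 0 <= B, 0 <= D &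
  L = (A - B + (C - D))%:E].
Proof.
have [m1E m2E _ _ _] := masses_fin; have [_ UE Lfin] := hU.
have mfin : plane_mass U.2 \is a fin_num by rewrite m2E.
move: UE; rewrite hybrid_energy0 half_line_energyE (plane_energyE _ _ mfin).
move: Lfin; rewrite -/L => /[swap] <-.
have : (0 <= normL half_line p U.1 `^ p)%E by exact: poweR_ge0.
have : (0 <= normL plane r U.2 `^ r)%E by exact: poweR_ge0.
have ip : 0 < p^-1 by rewrite invr_gt0.
have ir : 0 < r^-1 by rewrite invr_gt0.
case: (_ `^ p)%E => [a| |]//; case: (_ `^ r)%E => [b| |]//;
  rewrite ?gt0_muley ?lte_fin//= => b0 a0 _.
rewrite !lee_fin in a0 b0.
split; rewrite ?divr_ge0 ?(ltW p0) ?(ltW r0)//;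
  do ?[by congr EFin; field; rewrite gt_eqF].
by rewrite -!EFinD (mulrC a) (mulrC b).
Qed.

(** The pair [(c u, d v)] is a competitor once its mass is [mu]; the dichotomy and the massless
    cases use particular values of [c] and [d]. *)
Let scaled_energy_ge (c d : R) : 0 <= c -> 0 <= d ->
  c ^+ 2 * m1 + d ^+ 2 * m2 = mu ->
  A - B + (C - D) <= c ^+ 2 * A - c `^ p * B + (d ^+ 2 * C - d `^ r * D).
Proof.
move=> c0 d0 cdmu; have [m1E m2E _ _ _] := masses_fin.
have mfin : plane_mass U.2 \is a fin_num by rewrite m2E.
have [BE DE _ _ LE] := energies_fin.
have := @hybrid_level_le (scale_half_line c0 U.1, scale_plane d0 U.2).
rewrite /hybrid_mass half_line_mass_scale plane_mass_scale m1E m2E.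
rewrite -!EFinM -EFinD cdmu => /(_ erefl).
rewrite (half_line_energy_scale _ _ p0 BE).
rewrite (plane_energy_scale _ _ r0 mfin DE).
rewrite LE -EFinD lee_fin.
by rewrite ![_ * _ / _]mulrAC !mulfV ?gt_eqF// !mul1r.
Qed.

(** Write [x^q] as [x^2] times [x^(q-2)]; the last factor exceeds 1. *)
Let sqr_lt_powR (q x : R) : 2 < q -> 1 < x -> x ^+ 2 < x `^ q.
Proof.
move=> q2 x1; have x0 : 0 < x by rewrite (lt_trans ltr01).
rewrite -(subrKC 2 q) powRD; last by apply/implyP => _; rewrite gt_eqF.
rewrite powR_mulrn ?(ltW x0)// ltr_pMr ?exprn_gt0//.
have := gt0_ltr_powR (_ : 0 < q - 2) _ _ x1; rewrite powR1; apply.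
- by rewrite subr_gt0.
- by rewrite nnegrE.
- by rewrite nnegrE ltW.
Qed.

(** If [B] vanished, [u] would be 0 almost everywhere and have no mass. This is the source of
    strictness in the dichotomy. *)
Let half_line_power_gt0 : 0 < m1 -> 0 < B.
Proof.
have [BE _ B0 _ _] := energies_fin; rewrite [0 < B]lt_neqAle B0 andbT eq_sym.
apply: contraTneq => Beq0; move: BE; rewrite Beq0 mulr0.
move=> /poweR_eq0_eq0 -/(_ (normL_ge0 _ _ _)) nu0.
have mU := measurable_normc_half_line U.1.
rewrite /half_line_mass (ae0_normL (ltr0n _ 2) mU (normL_eq0 p0 mU nu0)).
by rewrite expe2 mul0e ltxx.
Qed.

Lemma hybrid_mass_dichotomy : half_line_mass U.1 = 0%E \/ plane_mass U.2 = 0%E.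
Proof.
have [m1E m2E m10 m20 m12] := masses_fin.
have [BE DE B0 D0 LE] := energies_fin.
rewrite m1E m2E.
move: (m1) (m2) (scaled_energy_ge) half_line_power_gt0 m10 m20 m12
  => n1 n2 test Bgt0.
rewrite le_eqVlt => /predU1P[<-|n10]; first by left.
rewrite le_eqVlt => /predU1P[<-|n20 n12]; first by right.
exfalso; have {}Bgt0 := Bgt0 n10.
have n1mu : n1 < mu by rewrite -n12 ltrDl.
have n2mu : n2 < mu by rewrite -n12 ltrDr.
(* These factors bring [u] alone, respectively [v] alone, to the full mass [mu]; both exceed 1
   because each part carries less than [mu]. *)
pose c := Num.sqrt (mu / n1); pose d := Num.sqrt (mu / n2).
have cE : c ^+ 2 = mu / n1 by rewrite sqr_sqrtr// divr_ge0// ltW.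
have dE : d ^+ 2 = mu / n2 by rewrite sqr_sqrtr// divr_ge0// ltW.
have c1 : 1 < c by rewrite -sqrtr1 ltr_sqrt ?divr_gt0// ltr_pdivlMr// mul1r.
have d1 : 1 < d by rewrite -sqrtr1 ltr_sqrt ?divr_gt0// ltr_pdivlMr// mul1r.
have [p2 r2] : 2 < p /\ 2 < r by move: hp hr => /andP[-> _] /andP[-> _].
have cp := sqr_lt_powR p2 c1; have dr := sqr_lt_powR r2 d1.
have := test c 0 (sqrtr_ge0 _) (lexx _).
rewrite cE divfK ?gt_eqF// expr0n/= !mul0r addr0 => /(_ erefl).
rewrite powR0 ?gt_eqF// mul0r subr0 addr0 => lec.
have := test 0 d (lexx _) (sqrtr_ge0 _).
rewrite dE divfK ?gt_eqF// expr0n/= !mul0r add0r => /(_ erefl).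
rewrite powR0 ?gt_eqF// mul0r subr0 add0r => led.
(* Strict because [B > 0]; for [v], [D >= 0] gives a weak inequality, which is enough. *)
have ltc : A - B + (C - D) < mu / n1 * (A - B).
  by rewrite (le_lt_trans lec)// mulrBr ltrD2l ltrN2 ltr_pM2r// -cE.
have {}led : A - B + (C - D) <= mu / n2 * (C - D).
  by rewrite (le_trans led)// mulrBr lerD2l lerN2 ler_wpM2r// -dE ltW.
(* With [X = A - B] and [Y = C - D]: [(X + Y) n1 < mu X] and [(X + Y) n2 <= mu Y] add up to
   [(X + Y) mu < mu (X + Y)]. *)
move: ltc led; rewrite [mu / n1 * _]mulrAC ltr_pdivlMr// [mu / n2 * _]mulrAC.
by rewrite ler_pdivlMr//; move: (A - B) (C - D) => X Y; nra.
Qed.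

(* Scaling u by 0 gives A - B <= 0, and scaling it by 2 gives
   A - B <= 4 A - 2^p B <= 4 (A - B), that is, A - B >= 0. *)
Lemma half_line_energy_massless :
  half_line_mass U.1 = 0%E -> half_line_energy alpha p U.1 = 0%E.
Proof.
move=> m10; have [_ _ _ _ m12] := masses_fin.
have [BE DE B0 D0 LE] := energies_fin.
have m20 : m2 = mu by rewrite -m12 m10 add0r.
have p2 : 2 < p by move: hp => /andP[].
have := scaled_energy_ge (lexx 0) ler01.
have := scaled_energy_ge (ler0n _ 2) ler01.
rewrite m10 m20 /= !mulr0 expr1n mul1r add0r => /(_ erefl) le2 /(_ erefl).
move: le2; rewrite powR1 !mul1r expr0n/= powR0 ?gt_eqF// !mul0r subr0.
rewrite !lerD2r => le2 le0.
have le4 : 2 ^+ 2 * A - 2 `^ p * B <= 2 ^+ 2 * A - 2 ^+ 2 * B.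
  by rewrite lerD2l lerN2 ler_wpM2r// ltW// sqr_lt_powR// ltr1n.
rewrite half_line_energyE BE -EFinM mulKf ?gt_eqF// -EFinB; congr EFin.
apply/eqP; rewrite eq_le le0/=.
by move: le4 le2; move: (A) (B) (2 `^ p) => a b t; nra.
Qed.

(** Zero mass alone does not say that the pair [(phi, q)] is zero, so the energy is again computed
    by dilation: [v] is scaled by 0 and by 2 while [u] is kept. *)
Lemma plane_energy_massless :
  plane_mass U.2 = 0%E -> plane_energy rho r U.2 = 0%E.
Proof.
move=> m20; have [_ _ _ _ m12] := masses_fin.
have [BE DE B0 D0 LE] := energies_fin.
have m10 : m1 = mu by rewrite -m12 m20 addr0.
have r2 : 2 < r by move: hr => /andP[].
have := scaled_energy_ge ler01 (lexx 0).
have := scaled_energy_ge ler01 (ler0n _ 2).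
rewrite m20 m10 /= !mulr0 expr1n mul1r addr0 => /(_ erefl) le2 /(_ erefl).
move: le2; rewrite powR1 !mul1r expr0n/= powR0 ?gt_eqF// !mul0r subr0.
rewrite !lerD2l => le2 le0.
have le4 : 2 ^+ 2 * C - 2 `^ r * D <= 2 ^+ 2 * C - 2 ^+ 2 * D.
  by rewrite lerD2l lerN2 ler_wpM2r// ltW// sqr_lt_powR// ltr1n.
rewrite plane_energyE ?m20// DE -EFinM mulKf ?gt_eqF// -EFinB; congr EFin.
apply/eqP; rewrite eq_le le0/=.
by move: le4 le2; move: (C) (D) (2 `^ r) => a b t; nra.
Qed.

(** The competitor is [(u, 0)], where 0 is [U.2] dilated by 0, with zero mass and energy. *)
Lemma hybrid_level_le_half_line (u : H1_half_line R) :
  half_line_mass u = mu%:E -> (L <= half_line_energy alpha p u)%E.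
Proof.
move=> mU; have [_ m2E _ _ _] := masses_fin; have [_ DE _ _ _] := energies_fin.
have mfin : plane_mass U.2 \is a fin_num by rewrite m2E.
have := @hybrid_level_le (u, scale_plane (lexx 0) U.2).
rewrite /hybrid_mass plane_mass_scale expr0n/= mul0e adde0 => /(_ mU).
rewrite (plane_energy_scale _ _ r0 mfin DE).
by rewrite expr0n/= powR0 ?gt_eqF// !mul0r subr0 adde0.
Qed.

Lemma hybrid_level_le_plane (v : energy_plane R) :
  plane_mass v = mu%:E -> (L <= plane_energy rho r v)%E.
Proof.
move=> mU; have [BE _ _ _ _] := energies_fin.
have := @hybrid_level_le (scale_half_line (lexx 0) U.1, v).
rewrite /hybrid_mass half_line_mass_scale expr0n/= mul0e add0e => /(_ mU).
rewrite (half_line_energy_scale _ _ p0 BE).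
by rewrite expr0n/= powR0 ?gt_eqF// !mul0r subr0 add0e.
Qed.

(** The massless part has no energy, so [U.1] attains the hybrid level, which bounds the half-line
    energy from below at mass [mu]; the two levels therefore coincide. *)
Lemma hybrid_ground_state_half_line : plane_mass U.2 = 0%E ->
  [/\ half_line_ground_state alpha p mu U.1,
    half_line_energy alpha p U.1 = L & ae_eq plane setT U.2 (fun=> 0)].
Proof.
move=> m20; have [mU UE Lfin] := hU.
have mU1 : half_line_mass U.1 = mu%:E.
  by move: mU; rewrite /hybrid_mass m20 adde0.
have EU : half_line_energy alpha p U.1 = L.
  by rewrite /hybrid_level -UE hybrid_energy0 plane_energy_massless// adde0.
have levelE : energy_level half_line_mass (half_line_energy alpha p) mu = L.
  apply/eqP; rewrite eq_le; apply/andP; split.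
    by rewrite -EU; apply: ereal_inf_lbound; exists U.1.
  by apply: le_ereal_inf_tmp => _ [u mu' <-]; exact: hybrid_level_le_half_line.
split => //.
- by split=> //; rewrite levelE.
- move: m20 => /eqP; rewrite expe_eq0/= => /eqP.
  exact: normL_eq0 (ltr0n _ 2) (measurable_normc_plane _).
Qed.

Lemma hybrid_ground_state_plane : half_line_mass U.1 = 0%E ->
  [/\ plane_ground_state rho r mu U.2,
    plane_energy rho r U.2 = L & ae_eq half_line setT U.1 (fun=> 0)].
Proof.
move=> m10; have [mU UE Lfin] := hU.
have mU2 : plane_mass U.2 = mu%:E by move: mU; rewrite /hybrid_mass m10 add0e.
have EU : plane_energy rho r U.2 = L.
  by rewrite /hybrid_level -UE hybrid_energy0 half_line_energy_massless// add0e.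
have levelE : energy_level plane_mass (plane_energy rho r) mu = L.
  apply/eqP; rewrite eq_le; apply/andP; split.
    by rewrite -EU; apply: ereal_inf_lbound; exists U.2.
  by apply: le_ereal_inf_tmp => _ [v mv <-]; exact: hybrid_level_le_plane.
split => //.
- by split=> //; rewrite levelE.
- move: m10 => /eqP; rewrite expe_eq0/= => /eqP.
  exact: normL_eq0 (ltr0n _ 2) (measurable_normc_half_line _).
Qed.

End Alternative.

(** * Assembly of cases (i) and (ii) *)

Theorem theorem3 (R : realType) (alpha rho p r mu : R)
  (hp : 2 < p < 6) (hr : 2 < r < 4) (hmu : 0 < mu)
  (U : hybrid R) (hU : hybrid_ground_state alpha 0 rho p r mu U) :
  exists c : R[i], `|c| = 1 /\
  (* (i) *)
  (forall phi0 : H1_half_line R,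
     half_line_ground_state alpha p mu phi0 ->
     (forall v0 : energy_plane R, plane_ground_state rho r mu v0 ->
        (half_line_energy alpha p phi0 <= plane_energy rho r v0)%E) ->
     [/\ (forall v0 : energy_plane R, plane_ground_state rho r mu v0 ->
            (half_line_energy alpha p phi0 < plane_energy rho r v0)%E) ->
         exists phi : H1_half_line R,
           half_line_ground_state alpha p mu phi /\
           multiple_is c U phi (fun=> 0),
         (exists v0 : energy_plane R, plane_ground_state rho r mu v0 /\
            half_line_energy alpha p phi0 = plane_energy rho r v0) ->
         (exists phi : H1_half_line R,
            half_line_ground_state alpha p mu phi /\
            multiple_is c U phi (fun=> 0)) \/
         (exists v : energy_plane R,
            plane_ground_state rho r mu v /\
            multiple_is c U (fun=> 0) v)
       & hybrid_level alpha 0 rho p r mu = half_line_energy alpha p phi0]) /\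
  (* (ii) *)
  (~ (exists phi0 : H1_half_line R,
        half_line_ground_state alpha p mu phi0 /\
        forall v0 : energy_plane R, plane_ground_state rho r mu v0 ->
          (half_line_energy alpha p phi0 <= plane_energy rho r v0)%E) ->
   exists v : energy_plane R,
     [/\ plane_ground_state rho r mu v,
         multiple_is c U (fun=> 0) v
       & hybrid_level alpha 0 rho p r mu = plane_energy rho r v]).
Proof.
have ae1 d (T : measurableType d) (m : {measure set T -> \bar R})
    (f g : T -> R[i]) : ae_eq m setT f g -> ae_eq m setT (fun x => 1 * f x) g.
  by apply: filterS => x /[apply]; rewrite mul1r.
(* The phase can be 1 because the components of [U] themselves serve as the ground states sought. *)
exists 1; split; first exact: normr1.
have alt : (half_line_ground_state alpha p mu U.1 /\
      half_line_energy alpha p U.1 = hybrid_level alpha 0 rho p r mu /\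
      multiple_is 1 U U.1 (fun=> 0)) \/
    (plane_ground_state rho r mu U.2 /\
      plane_energy rho r U.2 = hybrid_level alpha 0 rho p r mu /\
      multiple_is 1 U (fun=> 0) U.2).
  have [m1|m2] := hybrid_mass_dichotomy hp hr hmu hU; [right|left].
    have [gs E0 U0] := hybrid_ground_state_plane hp hr hU m1.
    by do 2?split=> //; split; apply: ae1 => //; exact: ae_eq_refl.
  have [gs E0 U0] := hybrid_ground_state_half_line hp hr hU m2.
  by do 2?split=> //; split; apply: ae1 => //; exact: ae_eq_refl.
split.
  move=> phi0 gs0 le0.
  have [m0 E0 _] := gs0.
  have L0 := hybrid_level_le_half_line hp hr hU m0.
  (* If [U] lives on the half-line, [U.1] and [phi0] share the minimal energy; if it lives on the
     plane, the assumed comparison with [U.2] reverses [L0]. *)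
  have LE : hybrid_level alpha 0 rho p r mu = half_line_energy alpha p phi0.
    have [[[_ gs _] [<- _]]|[gs [E2 _]]] := alt; first by rewrite E0 gs.
    by apply/eqP; rewrite eq_le L0 -E2 le0.
  split=> //.
  - move=> lt0; have [[gs [_ UE]]|[gs [E2 _]]] := alt; first by exists U.1.
    by have := lt0 _ gs; rewrite E2 LE ltxx.
  - by move=> _; have [[gs [_ UE]]|[gs [_ UE]]] := alt; [left|right];
      [exists U.1|exists U.2].
move=> nophi; have [[gs [E1 _]]|[gs [E2 UE]]] := alt; last by exists U.2.
(* Otherwise [U.1] would be a half-line ground state at the hybrid level, hence below every plane
   ground state, which is case (i). *)
exfalso; apply: nophi; exists U.1; split=> // v0 [mv _ _].
by rewrite E1; exact (hybrid_level_le_plane hp hr hU mv).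
Qed.
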